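(* For every integer $n\ge 1$, the following identities hold. (i) $$\sum_{\sigma\in B_n^{*}}(-1)^{\lfloor \mathrm{fwex}(\sigma)/2\rfloor}=(-1)^{\lfloor\frac{n}{2}\rfloor} S_n.$$ (ii) $$\sum_{\sigma\in D_n^{*}}(-1)^{\lfloor \mathrm{fwex}(\sigma)/2\rfloor}=\begin{cases}(-1)^{\frac n2} S_n & \text{if } n \text{ is even},\\ 0 & \text{if } n \text{ is odd}.\end{cases}$$
   Context: Let $[n]=\{1,\dots,n\}$. A signed permutation of $[n]$ is a bijection $\sigma$ of $\{-n,\dots,-1,1,\dots,n\}$ onto itself with $\sigma(-i)=-\sigma(i)$ for all $i$; it is written $\sigma=\sigma_1\sigma_2\cdots\sigma_n$ with $\sigma_i=\sigma(i)$. $B_n$ is the set of signed permutations of $[n]$, and $D_n\subset B_n$ is the subset of those with an even number of negative entries among $\sigma_1,\dots,\sigma_n$. $B_n^*$ (resp. $D_n^*$) is the subset of $B_n$ (resp. $D_n$) of elements with $\sigma_i\ne i$ for all $i\in[n]$. For $\sigma\in B_n$: $\mathrm{neg}(\sigma)=\#\{i\in[n]:\sigma_i<0\}$, $\mathrm{wex}(\sigma)=\#\{i\in[n]:\sigma_i\ge i\}$, and $\mathrm{fwex}(\sigma)=2\,\mathrm{wex}(\sigma)+\mathrm{neg}(\sigma)$. The Springer numbers $S_n$ (of type B) have exponential generating function $\sum_{n\ge 0} S_n\frac{x^n}{n!}=\frac{1}{\cos x-\sin x}$. *)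

(* Defs.v *)
From HB Require Import structures.
From mathcomp Require Import all_boot all_order all_algebra all_fingroup.

Set Implicit Arguments.
Unset Strict Implicit.
Unset Printing Implicit Defensive.

Import Order.TTheory GRing.Theory Num.Theory.

Local Open Scope ring_scope.

(* Ordinals are 0-based: (i, s) : letter n stands for the integer i + 1,
   negated when s = true, so that letter n is {-n, .., -1, 1, .., n}. *)
Definition letter (n : nat) : finType := ('I_n * bool)%type.

Definition letter_val (n : nat) (x : letter n) : int :=
  if x.2 then - (x.1.+1%:Z) else x.1.+1%:Z.

Definition pos_letter (n : nat) (i : 'I_n) : letter n := (i, false).

Definition opp_letter (n : nat) (x : letter n) : letter n := (x.1, ~~ x.2).

Lemma letter_val_inj (n : nat) : injective (@letter_val n).
Proof.
move=> [i s] [j t]; rewrite /letter_val /=.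
by case: s; case: t => //; [move/oppr_inj|]; case=> /ord_inj ->.
Qed.

Lemma letter_val_opp (n : nat) (x : letter n) :
  letter_val (opp_letter x) = - letter_val x.
Proof. by case: x => i [] //=; rewrite /letter_val /= opprK. Qed.

Definition signed_perms (n : nat) : {set {perm letter n}} :=
  [set s : {perm letter n} |
     [forall x : letter n, s (opp_letter x) == opp_letter (s x)]].

(* entry s i is the integer sigma_(i + 1). *)
Definition entry (n : nat) (s : {perm letter n}) (i : 'I_n) : int :=
  letter_val (s (pos_letter i)).

Definition neg (n : nat) (s : {perm letter n}) : nat :=
  #|[set i : 'I_n | entry s i < 0]|.

Definition wex (n : nat) (s : {perm letter n}) : nat :=
  #|[set i : 'I_n | i.+1%:Z <= entry s i]|.

Definition fwex (n : nat) (s : {perm letter n}) : nat :=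
  (2 * wex s + neg s)%N.

Definition even_signed_perms (n : nat) : {set {perm letter n}} :=
  [set s in signed_perms n | ~~ odd (neg s)].

Definition fixed_point_free (n : nat) (s : {perm letter n}) : bool :=
  [forall i : 'I_n, entry s i != i.+1%:Z].

Definition Bstar (n : nat) : {set {perm letter n}} :=
  [set s in signed_perms n | fixed_point_free s].

Definition Dstar (n : nat) : {set {perm letter n}} :=
  [set s in even_signed_perms n | fixed_point_free s].

(* A formal power series over rat is its sequence of coefficients. *)
Definition fps : Type := nat -> rat.

Definition fps_sub (a b : fps) : fps := fun n => a n - b n.

Definition fps_mul (a b : fps) : fps :=
  fun n => \sum_(k < n.+1) a k * b (n - k)%N.

(* b_0 = 1 / a_0 and b_n = - (a_1 b_(n-1) + .. + a_n b_0) / a_0. *)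
Fixpoint fps_inv_coefs (a : fps) (n : nat) : seq rat :=
  if n is m.+1 then
    let b := fps_inv_coefs a m in
    rcons b (- (a 0%N)^-1 * \sum_(k < m.+1) a k.+1 * b`_(m - k))
  else [:: (a 0%N)^-1].

Definition fps_inv (a : fps) : fps := fun n => (fps_inv_coefs a n)`_n.

Definition fps_cos : fps :=
  fun n => if odd n then 0 else (-1) ^+ n./2 / n`!%:R.

Definition fps_sin : fps :=
  fun n => if odd n then (-1) ^+ n./2 / n`!%:R else 0.

Definition springer (n : nat) : rat :=
  n`!%:R * fps_inv (fps_sub fps_cos fps_sin) n.

Lemma size_fps_inv_coefs (a : fps) (n : nat) :
  size (fps_inv_coefs a n) = n.+1.
Proof. by elim: n => //= n IHn; rewrite size_rcons IHn. Qed.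

Lemma nth_fps_inv_coefs (a : fps) (n k : nat) :
  (k <= n)%N -> (fps_inv_coefs a n)`_k = fps_inv a k.
Proof.
elim: n => [|n IHn]; first by rewrite leqn0 => /eqP ->.
rewrite leq_eqVlt ltnS => /predU1P[-> //|le_kn].
by rewrite /= nth_rcons size_fps_inv_coefs ltnS le_kn IHn.
Qed.

Lemma fps_mulV (a : fps) (n : nat) :
  a 0%N != 0 -> fps_mul a (fps_inv a) n = (n == 0%N)%:R.
Proof.
move=> a0; rewrite /fps_mul big_ord_recl /= subn0.
case: n => [|n]; first by rewrite big_ord0 addr0 /fps_inv /= divff.
rewrite {1}/fps_inv /= nth_rcons size_fps_inv_coefs ltnn eqxx.
rewrite mulrA mulrN divff // mulN1r; apply/eqP; rewrite addrC subr_eq0.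
apply/eqP/eq_bigr => k _.
by rewrite nth_fps_inv_coefs ?leq_subr.
Qed.

Lemma springer_egf (n : nat) :
  fps_mul (fps_sub fps_cos fps_sin) (fun k => springer k / k`!%:R) n
  = (n == 0%N)%:R.
Proof.
rewrite -(@fps_mulV (fps_sub fps_cos fps_sin)) //.
apply: eq_bigr => k _; congr (_ * _).
by rewrite /springer mulrAC divff ?mul1r // pnatr_eq0 -lt0n fact_gt0.
Qed.

(* Main.v *)
Require Import Defs.
From mathcomp Require Import all_boot all_order all_algebra all_fingroup.
From mathcomp Require Import all_field.
From mathcomp Require Import ring.

(** The parity of fwex is that of neg, and (-1) ^ floor(f / 2) is the sum of the
    real and imaginary parts of 'i ^ f.  Both identities are therefore read off
    the single complex number P = sum of 'i ^ fwex(s) over Bstar: the real part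
    of P is the sum over Dstar, its imaginary part the sum over the rest of
    Bstar.  Since the Springer numbers are rational, everything follows from
    P = 'i ^ n * S_n.

    To compute P, fix the underlying permutation p of a signed permutation and
    sum over the signs.  The sum factors over positions, and for a variable y
    in place of 'i a position contributes y + y ^ 2 at an excedance of p, 1 + y
    at a drop p x < x, and y at a fixed point, where only the negative sign
    is allowed ([sum_Bstar_fwex]).  At y = 'i these three weights are
    'i * (1 + 'i), 'i * (1 - 'i) and 'i * 1, so that P is 'i ^ n times the
    number [eulerian_sum (1 + 'i) (1 - 'i) 1 n], which must be shown to be S_n
    ([eulerian_sum_springer]).

    For this, make the weights depend on an indeterminate: let A_n be the sum
    with weights 'X + 'i, 'X - 'i and 'X, to be evaluated at 1.  Building the
    permutations of n + 1 points by inserting the largest point into the cycles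
    of a permutation of n points gives ([eulerian_sumS])
        A_(n+1) = 'X * A_n + ('X ^ 2 + 1) * A_n',
    which is the recurrence of the derivative polynomials of the secant: the
    n-th derivative of sec is sec * A_n(tan).  By Taylor's formula the
    exponential generating function of the A_n(t) is, for t = tan y,
    sec(x + y) / sec y = 1 / (cos x - t * sin x), as [binom_conv_cos_subX_sin]
    proves algebraically, and t = 1 gives the generating function
    1 / (cos x - sin x) of the Springer numbers. *)

Set Implicit Arguments.
Unset Strict Implicit.
Unset Printing Implicit Defensive.

Import Order.TTheory GRing.Theory Num.Theory.

Local Open Scope ring_scope.

(** * Permutations weighted by excedances, drops and fixed points *)

Definition arc_weight (R : nzRingType) (a b c : R) (n : nat) (s : 'S_n)
    (x : 'I_n) : R :=
  if (x < s x)%N then a else if (s x < x)%N then b else c.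

Definition eulerian_sum (R : nzRingType) (a b c : R) (n : nat) : R :=
  \sum_(s : 'S_n) \prod_(x < n) arc_weight a b c s x.

(** In cycle notation, the new largest point is put between j and s j, or made
    a fixed point when j is itself the new point: the product of permutations
    applies the transposition first. *)
Definition insert_max (n : nat) (j : 'I_n.+1) (s : 'S_n) : 'S_n.+1 :=
  (tperm ord_max j * lift_perm ord_max ord_max s)%g.

Lemma widen_ord_max (n : nat) (i : 'I_n) (le_n : (n <= n.+1)%N) :
  widen_ord le_n i = lift ord_max i.
Proof. by apply: ord_inj; rewrite lift_max. Qed.

(** The point j is recovered as the preimage of the largest point, and then s by
    cancelling the transposition. *)
Lemma insert_max_inj (n : nat) :
  injective (fun js : 'I_n.+1 * 'S_n => insert_max js.1 js.2).
Proof.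
move=> [j s] [k t] /= eq_jk.
have def_max (i : 'I_n.+1) (u : 'S_n) : insert_max i u i = ord_max.
  by rewrite permM tpermR lift_perm_id.
have eq_j : j = k.
  by apply: (@perm_inj _ (insert_max j s)); rewrite {2}eq_jk !def_max.
move: eq_jk; rewrite -{k}eq_j => /mulgI eq_st; congr (_, _).
apply/permP => i; apply: (@lift_inj _ ord_max).
by rewrite -!(lift_perm_lift ord_max) eq_st.
Qed.

(** Surjectivity of the insertion is obtained by counting:
    (n + 1) * n! = (n + 1)!. *)
Lemma sum_insert_max (V : nmodType) (n : nat) (F : 'S_n.+1 -> V) :
  \sum_s F s = \sum_(s : 'S_n) \sum_(j < n.+1) F (insert_max j s).
Proof.
have bij_ins : bijective (fun js : 'I_n.+1 * 'S_n => insert_max js.1 js.2).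
  apply: inj_card_bij; first exact: insert_max_inj.
  by rewrite card_prod card_ord !card_Sn factS.
rewrite (reindex _ (onW_bij _ bij_ins)) exchange_big /=.
by rewrite pair_big.
Qed.

Lemma prod_insert_fix (R : comNzRingType) (a b c : R) (n : nat) (s : 'S_n) :
  \prod_(x < n.+1) arc_weight a b c (insert_max ord_max s) x
  = c * \prod_(x < n) arc_weight a b c s x.
Proof.
rewrite /insert_max tperm1 mul1g big_ord_recr [RHS]mulrC /=; congr (_ * _).
  apply: eq_bigr => i _.
  by rewrite widen_ord_max /arc_weight lift_perm_lift !lift_max.
by rewrite /arc_weight lift_perm_id ltnn.
Qed.

(** The arc from k to s k is replaced by an arc up to the new largest point
    followed by an arc down from it, whichever kind of arc it was. *)
Lemma prod_insert_arc (R : comNzRingType) (a b c : R) (n : nat) (s : 'S_n)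
    (k : 'I_n) :
  \prod_(x < n.+1) arc_weight a b c (insert_max (lift ord_max k) s) x
  = a * b * \prod_(x < n | x != k) arc_weight a b c s x.
Proof.
rewrite big_ord_recr (bigD1 k) //= mulrAC; congr (_ * _ * _).
- rewrite widen_ord_max /arc_weight permM tpermR lift_perm_id lift_max.
  by rewrite ltn_ord.
- rewrite /arc_weight permM tpermL lift_perm_lift lift_max.
  by rewrite ltnNge ltnW /= ltn_ord.
apply: eq_bigr => i ne_ik.
rewrite widen_ord_max /arc_weight permM tpermD.
- by rewrite lift_perm_lift !lift_max.
- by rewrite neq_lift.
by rewrite (inj_eq (@lift_inj _ _)) eq_sym.
Qed.

Lemma deriv_prod (R : comNzRingType) (I : eqType) (r : seq I)
    (F : I -> {poly R}) :
  uniq r ->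
  (\prod_(i <- r) F i)^`() =
  \sum_(i <- r) (F i)^`() * \prod_(j <- r | j != i) F j.
Proof.
elim: r => [|x r IHr] /=; first by rewrite !big_nil derivC.
case/andP=> x_r uniq_r; rewrite !big_cons derivM IHr // eqxx /=.
congr (_ * _ + _).
  rewrite big_seq [RHS]big_seq_cond; apply: eq_bigl => j.
  by case: eqP => [->|]; rewrite ?(negPf x_r) ?andbT.
rewrite mulr_sumr [LHS]big_seq [RHS]big_seq; apply: eq_bigr => i i_r.
rewrite big_cons; case: eqP => [eq_xi|_]; last exact: mulrCA.
by rewrite eq_xi i_r in x_r.
Qed.

(** A new fixed point brings in a factor c, while insertion into an arc replaces
    one factor of the product by a * b.  As all three weights have derivative 1,
    the sum of the products with one factor removed is the derivative of the
    product. *)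
Lemma eulerian_sumS (R : comNzRingType) (a b c : {poly R}) (n : nat) :
  a^`() = 1 -> b^`() = 1 -> c^`() = 1 ->
  eulerian_sum a b c n.+1
  = c * eulerian_sum a b c n + a * b * (eulerian_sum a b c n)^`().
Proof.
move=> Da Db Dc; rewrite /eulerian_sum sum_insert_max raddf_sum !mulr_sumr.
rewrite -big_split /=; apply: eq_bigr => s _.
rewrite big_ord_recr prod_insert_fix addrC /=; congr (_ + _).
rewrite deriv_prod ?index_enum_uniq // mulr_sumr; apply: eq_bigr => k _.
rewrite widen_ord_max prod_insert_arc; congr (_ * _).
have -> : (arc_weight a b c s k)^`() = 1.
  by rewrite /arc_weight; case: ifP => // _; case: ifP.
by rewrite mul1r.
Qed.

Lemma eulerian_sum0 (R : nzRingType) (a b c : R) : eulerian_sum a b c 0 = 1.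
Proof.
rewrite /eulerian_sum (eq_bigr (fun=> 1)) => [|s _]; last by rewrite big_ord0.
by rewrite sumr_const card_Sn.
Qed.

Lemma eulerian_sumZ (R : comNzRingType) (t a b c : R) (n : nat) :
  eulerian_sum (t * a) (t * b) (t * c) n = t ^+ n * eulerian_sum a b c n.
Proof.
rewrite /eulerian_sum mulr_sumr; apply: eq_bigr => s _.
rewrite -[n in t ^+ n]card_ord -prodr_const -big_split /=.
by apply: eq_bigr => x _; rewrite /arc_weight; do 2?case: ifP.
Qed.

Lemma rmorph_eulerian_sum (R S : nzRingType) (f : {rmorphism R -> S})
    (a b c : R) (n : nat) :
  f (eulerian_sum a b c n) = eulerian_sum (f a) (f b) (f c) n.
Proof.
rewrite rmorph_sum; apply: eq_bigr => s _; rewrite rmorph_prod.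
by apply: eq_bigr => x _; rewrite /arc_weight; do 2?case: ifP.
Qed.

(** * Derivative polynomials of the secant *)

(** The product of exponential generating functions, on coefficients. *)
Definition binom_conv (R : nzRingType) (f g : nat -> R) (n : nat) : R :=
  \sum_(k < n.+1) f k * g (n - k)%N *+ 'C(n, k).

(** The product rule for exponential generating functions, on which [succn] acts
    as the derivative; on coefficients it is Pascal's rule. *)
Lemma binom_convS (R : nzRingType) (f g : nat -> R) (n : nat) :
  binom_conv f g n.+1
  = binom_conv (f \o succn) g n + binom_conv f (g \o succn) n.
Proof.
rewrite /binom_conv big_ord_recl /= bin0 subn0.
under eq_bigr => k _ do rewrite /bump /= add1n subSS binS mulrnDr.
rewrite big_split /= addrA addrC; congr (_ + _).
rewrite big_ord_recr /= bin_small // mulr0n addr0.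
rewrite [RHS]big_ord_recl /= bin0 subn0; congr (_ + _).
by apply: eq_bigr => k _; rewrite /bump /= add1n subnSK.
Qed.

(** The coefficients of x ^ n / n! in cos x - 'X * sin x. *)
Definition cos_subX_sin (R : comNzRingType) (n : nat) : {poly R} :=
  (-1) ^+ n./2 * (if odd n then - 'X else 1).

Lemma deriv_sign (R : comNzRingType) (k : nat) : ((-1) ^+ k : {poly R})^`() = 0.
Proof. by rewrite -polyCN -polyC_exp derivC. Qed.

(** With D = (1 + 'X ^ 2) * d/d'X and U = cos x - 'X * sin x, both sides are
    the coefficients of D U = dU/dx + 'X * U = - (1 + 'X ^ 2) * sin x. *)
Lemma cos_subX_sinS (R : comNzRingType) (n : nat) :
  (1 + 'X^2) * (cos_subX_sin R n)^`()
  = cos_subX_sin R n.+1 + 'X * cos_subX_sin R n.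
Proof.
rewrite /cos_subX_sin derivM deriv_sign mul0r add0r /= uphalf_half.
case: (odd n); rewrite /= ?add1n ?exprS ?derivN ?derivX ?derivC ?expr1; ring.
Qed.

(** Let A(x) be the generating function of the A m, and D, U be as above.  The
    terms in 'X * U * A cancel in d(U A)/dx = (D U - 'X * U) * A
    + U * ('X * A + D A), which leaves d(U A)/dx = D (U A).  Since U A has
    constant term 1 and D 1 = 0, all its other coefficients vanish. *)
Lemma binom_conv_cos_subX_sin (R : comNzRingType) (A : nat -> {poly R})
    (n : nat) :
  A 0 = 1 ->
  (forall m, A m.+1 = 'X * A m + (1 + 'X^2) * (A m)^`()) ->
  binom_conv (cos_subX_sin R) A n = (n == 0)%:R.
Proof.
move=> A0 AS; have step m : binom_conv (cos_subX_sin R) A m.+1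
    = (1 + 'X^2) * (binom_conv (cos_subX_sin R) A m)^`().
  rewrite binom_convS /binom_conv raddf_sum mulr_sumr -big_split /=.
  apply: eq_bigr => k _; rewrite AS derivMn derivM -mulrnDl mulrnAr.
  congr (_ *+ _).
  by rewrite [RHS]mulrDr [X in _ = X + _]mulrA cos_subX_sinS /=; ring.
elim: n => [|n IHn].
  by rewrite /binom_conv big_ord1 A0 /cos_subX_sin /= !mulr1.
by rewrite step IHn; case: n {IHn} => [|n]; rewrite ?derivC mulr0.
Qed.

(** A power series with constant term 1 can be cancelled. *)
Lemma binom_conv_inj (R : nzRingType) (u f g : nat -> R) :
  u 0 = 1 -> binom_conv u f =1 binom_conv u g -> f =1 g.
Proof.
move=> u0 eq_fg n; elim/ltn_ind: n => n IHn.
move: (eq_fg n); rewrite /binom_conv !big_ord_recl /= u0 !bin0 !subn0 !mul1r.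
set S1 := \sum_(i < n) _; have -> : S1 = \sum_(i < n)
    u (bump 0 i) * g (n - bump 0 i)%N *+ 'C(n, bump 0 i).
  by apply: eq_bigr => i _; rewrite IHn // /bump add1n subnSK // leq_subr.
exact: addIr.
Qed.

Lemma binom_conv_springer (n : nat) :
  binom_conv (fun k => (cos_subX_sin rat k).[1]) springer n = (n == 0)%:R.
Proof.
suff -> : binom_conv (fun k => (cos_subX_sin rat k).[1]) springer n
  = n`!%:R * fps_mul (fps_sub fps_cos fps_sin)
      (fun k => springer k / k`!%:R) n.
  by rewrite springer_egf; case: n => [|n]; rewrite ?mulr1 ?mulr0.
rewrite /binom_conv /fps_mul mulr_sumr; apply: eq_bigr => k _.
have le_kn : (k <= n)%N by rewrite -ltnS.
have -> : (cos_subX_sin rat k).[1]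
    = k`!%:R * fps_sub fps_cos fps_sin k.
  have k0 : (k`!%:R : rat) != 0 by rewrite pnatr_eq0 -lt0n fact_gt0.
  rewrite /cos_subX_sin hornerM -polyCN -polyC_exp hornerC.
  rewrite /fps_sub /fps_cos /fps_sin; case: (odd k).
    by rewrite hornerN hornerX; field.
  by rewrite hornerC; field.
rewrite -mulr_natr -(bin_fact le_kn) !natrM.
have nk0 : ((n - k)`!%:R : rat) != 0 by rewrite pnatr_eq0 -lt0n fact_gt0.
by field.
Qed.

(** The weights 'X + 'i and 'X - 'i are chosen for their product 'X ^ 2 + 1,
    which turns the insertion recurrence into that of the secant. *)
Lemma eulerian_sum_springer (n : nat) :
  eulerian_sum (1 + 'i) (1 - 'i) 1 n = ratr (springer n) :> algC.
Proof.
pose A := eulerian_sum ('X + 'i%:P) ('X - 'i%:P) ('X : {poly algC}).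
have A_sec m : binom_conv (cos_subX_sin algC) A m = (m == 0)%:R.
  apply: binom_conv_cos_subX_sin; first exact: eulerian_sum0.
  move=> k; rewrite /A eulerian_sumS ?derivD ?derivN ?derivX ?derivC;
    rewrite ?oppr0 ?addr0 //.
  rewrite [('X + _) * _]mulrC -subr_sqr -polyC_exp sqrCi polyCN opprK.
  by rewrite [_ + 1]addrC.
have eA m : eulerian_sum (1 + 'i) (1 - 'i) 1 m = (A m).[1] :> algC.
  rewrite -[RHS]/(horner_eval 1 (A m)) rmorph_eulerian_sum /=.
  by rewrite rmorphD rmorphB /= /horner_eval !hornerC !hornerX.
apply: (@binom_conv_inj algC (fun k => (cos_subX_sin algC k).[1])
          (eulerian_sum (1 + 'i) (1 - 'i) 1) (ratr \o springer)) => [|m].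
  by rewrite /cos_subX_sin mul1r hornerC.
transitivity ((m == 0)%:R : algC).
  rewrite -[RHS](hornerC _ 1) polyC_natr -A_sec horner_sum.
  by apply: eq_bigr => k _; rewrite hornerMn [in RHS]hornerM eA.
rewrite -[LHS](ratr_nat algC) -binom_conv_springer rmorph_sum.
apply: eq_bigr => k _; rewrite rmorphMn rmorphM /=; congr (_ * _ *+ _).
rewrite /cos_subX_sin !hornerM -!polyCN -!polyC_exp !hornerC rmorphM /=.
rewrite rmorphXn rmorphN1; congr (_ * _).
by case: (odd k); rewrite ?hornerN ?hornerX ?hornerC ?rmorphN rmorph1.
Qed.

(** * Summing over the signs of a signed permutation *)

Definition signed_fun (n : nat) (p : 'S_n) (e : {ffun 'I_n -> bool})
    (x : letter n) : letter n :=
  (p x.1, x.2 (+) e x.1).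

Lemma signed_fun_inj (n : nat) (p : 'S_n) (e : {ffun 'I_n -> bool}) :
  injective (signed_fun p e).
Proof. by move=> [i s] [j t] [/perm_inj-> /addIb->]. Qed.

Definition signed_perm (n : nat) (pe : 'S_n * {ffun 'I_n -> bool}) :
    {perm letter n} :=
  perm (@signed_fun_inj n pe.1 pe.2).

Lemma signed_perm_inj (n : nat) : injective (@signed_perm n).
Proof.
move=> [p e] [q f] /permP eq_pq.
have {}eq_pq i : (p i, e i) = (q i, f i).
  by have := eq_pq (pos_letter i); rewrite !permE.
by congr (_, _); [apply/permP | apply/ffunP] => i; case: (eq_pq i).
Qed.

(** A signed permutation is determined by its values on positive letters; their
    absolute values are distinct because two letters with the same absolute
    value are equal or opposite. *)
Lemma signed_permsE (n : nat) :
  signed_perms n = [set signed_perm pe | pe in predT].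
Proof.
apply/setP => s; rewrite inE; apply/forallP/imsetP => [opp_s | [pe _ ->] x];
  last by rewrite !permE /signed_fun /= addNb.
have s_opp x : s (opp_letter x) = opp_letter (s x) by apply/eqP.
have inj_abs : injective (fun i => (s (pos_letter i)).1).
  move=> i j /=; case si: (s (pos_letter i)) => [k t].
  case sj: (s (pos_letter j)) => [l u] /= eq_kl.
  case: (eqVneq t u) => [eq_tu | ne_tu].
    suff [] : pos_letter i = pos_letter j by [].
    by apply: (@perm_inj _ s); rewrite si sj eq_kl eq_tu.
  suff [] : pos_letter i = opp_letter (pos_letter j) by [].
  apply: (@perm_inj _ s); rewrite s_opp si sj eq_kl /opp_letter /=.
  by congr (_, _); case: t u ne_tu {si sj} => [] [].
exists (perm inj_abs, [ffun i => (s (pos_letter i)).2]) => //.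
apply/permP => -[i b]; rewrite permE /signed_fun /= permE ffunE.
case: b => /=; last by rewrite /pos_letter -surjective_pairing.
by have := s_opp (pos_letter i); rewrite /opp_letter.
Qed.

Lemma sum_signed_perms (V : nmodType) (n : nat) (F : {perm letter n} -> V) :
  \sum_(s in signed_perms n) F s
  = \sum_(p : 'S_n) \sum_(e : {ffun 'I_n -> bool}) F (signed_perm (p, e)).
Proof.
rewrite signed_permsE big_imset /=; last first.
  by move=> ? ? _ _; apply: signed_perm_inj.
by rewrite pair_big; apply: eq_bigr => -[].
Qed.

Lemma entry_signed_perm (n : nat) (p : 'S_n) (e : {ffun 'I_n -> bool}) i :
  entry (signed_perm (p, e)) i
  = if e i then - ((p i).+1%:Z) else (p i).+1%:Z.
Proof. by rewrite /entry permE. Qed.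

Lemma exp_fwex (R : comNzRingType) (y : R) (n : nat) (p : 'S_n)
    (e : {ffun 'I_n -> bool}) :
  y ^+ fwex (signed_perm (p, e))
  = \prod_(i < n) (if e i then y else if (i <= p i)%N then y ^+ 2 else 1).
Proof.
rewrite /fwex /wex /neg exprD exprM -!prodr_const.
rewrite big_mkcond [X in _ * X]big_mkcond -big_split /=.
apply: eq_bigr => i _; rewrite !inE entry_signed_perm.
case: (e i); first by rewrite oppr_lt0 mul1r.
by rewrite lez_nat ltnS mulr1.
Qed.

Lemma fixed_point_free_signed_perm (n : nat) (p : 'S_n)
    (e : {ffun 'I_n -> bool}) :
  fixed_point_free (signed_perm (p, e)) = [forall i, e i || (p i != i)].
Proof.
apply: eq_forallb => i; rewrite entry_signed_perm.
by case: (e i) => //=; rewrite eqz_nat eqSS.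
Qed.

(** Once the sum over the signs is exchanged with the product over positions,
    the condition of having no fixed point becomes a factor 0 for the positive
    sign at each fixed point of p. *)
Lemma sum_Bstar_fwex (R : comNzRingType) (y : R) (n : nat) :
  \sum_(s in Bstar n) y ^+ fwex s
  = eulerian_sum (y * (1 + y)) (1 + y) y n.
Proof.
transitivity (\sum_(s in signed_perms n)
    (if fixed_point_free s then y ^+ fwex s else 0)).
  by rewrite -big_mkcondr; apply: eq_bigl => s; rewrite inE.
rewrite sum_signed_perms; apply: eq_bigr => p _.
pose w (i : 'I_n) (b : bool) : R :=
  if b then y else if p i == i then 0 else if (i <= p i)%N then y ^+ 2 else 1.
transitivity (\sum_(e : {ffun 'I_n -> bool}) \prod_i w i (e i)).
  apply: eq_bigr => e _; rewrite fixed_point_free_signed_perm exp_fwex.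
  case: forallP => [fpf | /forallP].
    by apply: eq_bigr => i _; rewrite /w; case: (e i) (fpf i) => //= /negPf->.
  rewrite negb_forall => /existsP[i]; rewrite negb_or negbK => /andP[ei pi].
  by rewrite (bigD1 i) //= /w (negPf ei) pi mul0r.
rewrite -bigA_distr_bigA; apply: eq_bigr => i _.
rewrite big_bool /w /arc_weight -val_eqE /=.
by case: ltngtP => _; rewrite ?addr0 //; ring.
Qed.

(** * Real and imaginary parts *)

Lemma expCi (f : nat) :
  'i ^+ f = ratr ((-1) ^+ f./2) * (if odd f then 'i else 1) :> algC.
Proof.
rewrite -{1}[f]odd_double_half exprD -mul2n exprM sqrCi mulrC rmorphXn rmorphN1.
by case: (odd f).
Qed.

Lemma ratr_rect_inj (a b c d : rat) :
  ratr a + 'i * ratr b = ratr c + 'i * ratr d :> algC -> a = c /\ b = d.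
Proof.
have real_ratr (q : rat) : (ratr q : algC) \is Num.real.
  exact/Creal_Crat/Crat_rat.
move=> eq_abcd; split; apply: (fmorph_inj (ratr : rat -> algC)).
  by have := congr1 (fun z => 'Re z) eq_abcd; rewrite !Re_rect.
by have := congr1 (fun z => 'Im z) eq_abcd; rewrite !Im_rect.
Qed.

Theorem corollary1p6 (n : nat) (n_ge1 : (1 <= n)%N) :
  (\sum_(s in Bstar n) (-1) ^+ (fwex s)./2 = (-1) ^+ n./2 * springer n)
  /\
  (\sum_(s in Dstar n) (-1) ^+ (fwex s)./2
   = if odd n then 0 else (-1) ^+ n./2 * springer n).
Proof.
pose E : rat := \sum_(s in Bstar n | ~~ odd (neg s)) (-1) ^+ (fwex s)./2.
pose O : rat := \sum_(s in Bstar n | odd (neg s)) (-1) ^+ (fwex s)./2.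
pose S := (-1) ^+ n./2 * springer n.
have -> : \sum_(s in Bstar n) (-1) ^+ (fwex s)./2 = E + O.
  by rewrite addrC [LHS](bigID (fun s => odd (neg s))).
have -> : \sum_(s in Dstar n) (-1) ^+ (fwex s)./2 = E.
  by apply: eq_bigl => s; rewrite !inE andbAC.
have odd_fwex (s : {perm letter n}) : odd (fwex s) = odd (neg s).
  by rewrite oddD oddM.
suff [-> ->] : E = (if odd n then 0 else S) /\ O = (if odd n then S else 0).
  by rewrite -/S; case: (odd n); rewrite ?add0r ?addr0.
apply: ratr_rect_inj.
transitivity (\sum_(s in Bstar n) 'i ^+ fwex s : algC).
  rewrite [RHS](bigID (fun s => odd (neg s))) addrC /= !rmorph_sum mulr_sumr.
  congr (_ + _); apply: eq_bigr => s /andP[_ neg_s]; rewrite expCi odd_fwex.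
    by rewrite neg_s mulrC.
  by rewrite (negPf neg_s) mulr1.
have factor_i : 1 + 'i = 'i * (1 - 'i) :> algC.
  by rewrite mulrBr mulr1 -expr2 sqrCi opprK addrC.
(* A factor 'i is taken out of each of the three weights. *)
transitivity (eulerian_sum ('i * (1 + 'i)) ('i * (1 - 'i)) ('i * 1) n : algC).
  by rewrite sum_Bstar_fwex mulr1 -factor_i.
rewrite eulerian_sumZ eulerian_sum_springer expCi mulrAC -rmorphM -/S.
by case: (odd n); rewrite rmorph0 ?mulr0 ?mulr1 ?add0r ?addr0 // mulrC.
Qed.
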